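(* Let $n\ge 1$ and let $\Phi$ be the root system of type $A_n$ with positive roots $\Phi^+$. For integers $1\le a\le b\le n+1$ with $a+b\le n+1$, define $$ s_{a,b} := \#\left\{S \subseteq \Phi^+ \mid \#S=n+1 \text{ and } \operatorname{sign}(S)=\{a,b\} \right\} $$ and $$ u_{a,b} := (n+1)^{n+1-a-b} \binom{n}{a+b-1} \left\langle {a+b-1 \atop a-1}\right\rangle. $$ Then $s_{a,b}=u_{a,b}$ if $a<b$; $s_{a,b}=\tfrac12 u_{a,b}$ if $a=b\ne 1$; and $s_{a,b}=0$ if $a=b=1$.
   Context: Let $\epsilon_1,\dots,\epsilon_{n+1}$ be the standard basis of $\mathbb{R}^{n+1}$. The simple roots are $\alpha_i=\epsilon_i-\epsilon_{i+1}$ ($1\le i\le n$) and the positive roots are $\alpha_{i,j}=\epsilon_i-\epsilon_j=\sum_{k=i}^{j-1}\alpha_k$ for $1\le i<j\le n+1$. Each positive root $\beta=\sum_i c_i\alpha_i$ is identified with its coefficient vector $(c_1,\dots,c_n)^T\in\mathbb{Z}^n$. For a tuple $(\gamma_1,\dots,\gamma_n)$ of positive roots, $\det(\gamma_1,\dots,\gamma_n)$ is the determinant of the $n\times n$ matrix whose columns are their coefficient vectors (it lies in $\{-1,0,1\}$). For a tuple $S=(\beta_1,\dots,\beta_{n+1})$ of positive roots, set $d_k=(-1)^k\det(\beta_1,\dots,\widehat{\beta_k},\dots,\beta_{n+1})$ for $1\le k\le n+1$ (hat means omission); the signature $\operatorname{sign}(S)$ is the unordered pair $\{a,b\}$ where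 $a$ is the number of $k$ with $d_k=1$ and $b$ the number with $d_k=-1$. For a set $S$ of $n+1$ distinct positive roots, $\operatorname{sign}(S)$ is the signature of any ordering of $S$ as a tuple (it is independent of the ordering). The Eulerian number $\left\langle {m \atop k}\right\rangle$ ($0\le k\le m-1$) is the number of permutations $\sigma$ of $[m]=\{1,\dots,m\}$ with exactly $k$ descents, a descent being $i\in[m-1]$ with $\sigma(i)>\sigma(i+1)$. *)

(* Defs.v *)
From HB Require Import structures.
From mathcomp Require Import all_boot all_order all_fingroup all_algebra.

Set Implicit Arguments.
Unset Strict Implicit.
Unset Printing Implicit Defensive.

Import Order.TTheory GRing.Theory Num.Theory.
Local Open Scope ring_scope.

(* All indices are zero-based: the pair (i, j) with 0 <= i < j <= n stands for
   the positive root e_(i+1) - e_(j+1), and k : 'I_n for the simple root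
   e_(k+1) - e_(k+2). *)

Definition posroot (n : nat) := {p : 'I_n.+1 * 'I_n.+1 | (p.1 < p.2)%N}.

Definition eps (R : realFieldType) (n : nat) (i : 'I_n.+1) : 'rV[R]_n.+1 :=
  delta_mx 0 i.

Definition simple_root (R : realFieldType) (n : nat) (k : 'I_n) : 'rV[R]_n.+1 :=
  eps R (widen_ord (leqnSn n) k) - eps R (lift ord0 k).

Definition root_vec (R : realFieldType) (n : nat) (r : posroot n) :
    'rV[R]_n.+1 :=
  eps R (val r).1 - eps R (val r).2.

(* The coordinates of a positive root on the simple roots; see root_vecE and
   simple_root_free. *)
Definition root_coef (n : nat) (r : posroot n) (k : 'I_n) : int :=
  if ((val r).1 <= k < (val r).2)%N then 1 else 0.

Lemma root_vecE (R : realFieldType) (n : nat) (r : posroot n) :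
  root_vec R r = \sum_(k < n) (root_coef r k)%:~R *: simple_root R k.
Proof.
case: r => -[i j] /= lt_ij; rewrite /root_vec /root_coef /=.
have le_jn : (j <= n)%N by rewrite -ltnS.
pose e k : 'rV[R]_n.+1 := eps R (inord k).
have -> : eps R i - eps R j = \sum_(i <= k < j) (e k - e k.+1).
  by rewrite -[RHS]opprK -sumrN; under eq_bigr do rewrite opprB;
     rewrite telescope_sumr 1?ltnW // opprB /e !inord_val.
rewrite (big_nat_widen _ _ n) // (big_nat_widenl _ 0%N) // big_mkord.
rewrite big_mkcond; apply: eq_bigr => k _ /=; rewrite andbC.
case: ifP => _; last by rewrite scale0r.
rewrite scale1r /simple_root /e; congr (eps _ _ - eps _ _); apply: val_inj.
  by rewrite /= inordK // ltnS ltnW.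
by rewrite /= inordK // ltnS.
Qed.

Lemma simple_root_free (R : realFieldType) (n : nat) (c : 'I_n -> R) :
  \sum_(k < n) c k *: simple_root R k = 0 -> forall k, c k = 0.
Proof.
move=> c0.
suff IH : forall m (k : 'I_n), k = m :> nat -> c k = 0 by move=> k; exact: IH.
elim/ltn_ind => m IH k km.
have /rowP/(_ (widen_ord (leqnSn n) k)) := c0.
rewrite summxE mxE (bigD1 k) //= big1 ?addr0 => [|l neq_lk]; last first.
  rewrite !mxE /=; case: (ltnP l k) => [lt_lk|le_kl].
    by rewrite (IH l _ l) ?mul0r // -km.
  have lt_kl : (k < l)%N by rewrite ltn_neqAle eq_sym neq_lk.
  rewrite -!val_eqE /= /bump /= add1n.
  by rewrite (ltn_eqF lt_kl) (ltn_eqF (ltnW lt_kl : (k < l.+1)%N)) subrr mulr0.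
rewrite !mxE -!val_eqE /= /bump /= add1n eqxx.
by rewrite (ltn_eqF (ltnSn k)) subr0 mulr1.
Qed.

Definition root_det (n : nat) (g : 'I_n -> posroot n) : int :=
  \det (\matrix_(i < n, j < n) root_coef (g j) i).

(* The exponent k.+1 is the one-based position of the omitted entry. *)
Definition omit_det (n : nat) (t : n.+1.-tuple (posroot n)) (k : 'I_n.+1) :
    int :=
  (-1) ^+ k.+1 * root_det (fun j => tnth t (lift k j)).

(* Unordered pairs of naturals are two-element sequences up to perm_eq. *)
Definition signature (n : nat) (t : n.+1.-tuple (posroot n)) : seq nat :=
  [:: #|[set k | omit_det t k == 1]|; #|[set k | omit_det t k == -1]|].

Definition is_ordering (n : nat) (S : {set posroot n})
    (t : n.+1.-tuple (posroot n)) : bool :=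
  uniq t && ([set x in t] == S).

(* One ordering suffices, by signature_ordering below. *)
Definition has_sign (n : nat) (S : {set posroot n}) (a b : nat) : bool :=
  [exists t : n.+1.-tuple (posroot n),
     is_ordering S t && perm_eq (signature t) [:: a; b]].

Lemma omit_det_cofactor (n : nat) (t : n.+1.-tuple (posroot n)) (k : 'I_n.+1) :
  omit_det t k = - \det (\matrix_(i < n.+1, j < n.+1)
    oapp (root_coef (tnth t j)) (j == k)%:R (unlift ord0 i)).
Proof.
rewrite (expand_det_row _ ord0) (bigD1 k) //= big1 ?addr0 => [|j neq_jk].
  rewrite /omit_det exprS mulN1r mulNr; congr (- _).
  rewrite mxE unlift_none /= eqxx mul1r /cofactor /= add0n.
  congr (_ * \det _); apply/matrixP => i j.
  by rewrite !mxE liftK.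
by rewrite mxE unlift_none /= (negbTE neq_jk) mul0r.
Qed.

Lemma omit_det_perm (n : nat) (t u : n.+1.-tuple (posroot n)) (s : 'S_n.+1) :
    (forall k, tnth u k = tnth t (s k)) ->
  forall k, omit_det u k = (-1) ^+ s * omit_det t (s k).
Proof.
move=> tu k; rewrite !omit_det_cofactor mulrN -det_perm mulrC.
rewrite -[\det (perm_mx s)]det_tr tr_perm_mx -det_mulmx -col_permE.
congr (- \det _); apply/matrixP => i j; rewrite !mxE tu.
by rewrite (inj_eq perm_inj).
Qed.

Lemma signature_ordering (n : nat) (S : {set posroot n})
    (t u : n.+1.-tuple (posroot n)) :
  is_ordering S t -> is_ordering S u -> perm_eq (signature t) (signature u).
Proof.
move=> /andP[Ut /eqP St] /andP[Uu /eqP Su].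
have /tuple_permP[s def_u] : perm_eq u t.
  apply: uniq_perm => // x.
  by have /setP/(_ x) := etrans Su (esym St); rewrite !inE.
have {}def_u k : tnth u k = tnth t (s k).
  have -> : u = [tuple tnth t (s i) | i < n.+1] by exact: val_inj.
  by rewrite tnth_mktuple.
have duE := omit_det_perm def_u.
have cardE (c : int) :
    #|[set k | omit_det u k == c]| = #|[set k | omit_det t k == (-1) ^+ s * c]|.
  rewrite -(card_imset _ (@perm_inj _ s)); apply: eq_card => k.
  rewrite inE; apply/imsetP/eqP => [[l]|def_k].
    by rewrite inE duE => /eqP<- ->; rewrite signrMK.
  exists (s^-1 k)%g; rewrite ?permKV // inE duE permKV def_k signrMK //.
rewrite /signature !cardE; case: (odd_perm s); rewrite /= ?expr1 ?mulN1r ?opprK.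
  by rewrite (perm_catC [:: _] [:: _]).
by rewrite expr0 !mul1r.
Qed.

Definition descents (m : nat) (s : 'S_m) : {set 'I_m} :=
  [set i : 'I_m | [exists j : 'I_m, (j == i.+1 :> nat) && (s j < s i)%N]].

Definition eulerian (m k : nat) : nat :=
  #|[set s : 'S_m | #|descents s| == k]|.

Definition s_num (n a b : nat) : nat :=
  #|[set S : {set posroot n} | (#|S| == n.+1) && has_sign S a b]|.

Definition u_num (n a b : nat) : nat :=
  (n.+1 ^ (n.+1 - a - b) * 'C(n, a + b - 1) * eulerian (a + b - 1) (a - 1))%N.

(* Main.v *)
Require Import Defs.
From HB Require Import structures.
From mathcomp Require Import all_boot all_order all_fingroup all_algebra.

(** Positive roots are the edges of the complete graph on n+1 vertices, and a
    set S of n+1 of them has a nonzero signature only if it is a connected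
    graph with exactly one cycle. Orienting that cycle and pointing all other
    vertices towards it turns S into the edges {v, f v} of a self-map f whose
    recurrent points (those reachable from everywhere) are the vertices of the
    cycle; S comes from exactly two such maps, which traverse the cycle in
    opposite directions. Up to a global sign, d_v is 0 off the cycle and
    records whether v < f v on it, so the signature counts the ascents and
    descents of f around the cycle.

    It remains to count maps. Cutting the cycle at its maximum identifies the
    cyclic orders of a given c-set with a descents and the permutations of c-1
    letters with a-1 descents. The number of ways to attach the other vertices
    is c (n+1)^(n-c): each attachment contributes 1 to a sum, over all maps, of
    determinants that vanish for the maps with another cycle, and by
    multilinearity this sum is a single determinant. *)

Set Implicit Arguments.
Unset Strict Implicit.
Unset Printing Implicit Defensive.

Import GRing.Theory Num.Theory.

(** * Maps absorbed by a set, and their determinants *)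

Definition meets (T : finType) (Z : {set T}) (f : T -> T) (u : T) :=
  [exists z in Z, fconnect f u z].

Definition absorbing (T : finType) (Z : {set T}) (f : T -> T) :=
  [forall u, meets Z f u].

Lemma meetsP (T : finType) (Z : {set T}) (f : T -> T) (u : T) :
  reflect (exists k, iter k f u \in Z) (meets Z f u).
Proof.
apply: (iffP exists_inP) => [[z zZ uz]|[k kZ]].
  by exists (findex f u z); rewrite iter_findex.
by exists (iter k f u); rewrite ?fconnect_iter.
Qed.

Lemma meets_step (T : finType) (Z : {set T}) (f : T -> T) (u : T) :
  meets Z f u = (u \in Z) || meets Z f (f u).
Proof.
apply/meetsP/orP => [[[|k] kZ]|[uZ|/meetsP[k kZ]]]; first by left.
- by right; apply/meetsP; exists k; rewrite -iterSr.
- by exists 0.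
- by exists k.+1; rewrite iterSr.
Qed.

Section Determinants.

Local Open Scope ring_scope.

(* Column [j] is the [j]-th basis vector if [j \in Z], and otherwise the
   [j]-th minus the [f j]-th basis vector. *)
Definition absorbing_mx (R : pzRingType) (n : nat) (Z : {set 'I_n})
    (f : 'I_n -> 'I_n) : 'M[R]_n :=
  \matrix_(i, j) ((i == j)%:R - ((j \notin Z) && (i == f j))%:R).

Lemma absorbing_mx_row (R : pzRingType) (n : nat) (Z : {set 'I_n})
    (f : 'I_n -> 'I_n) (y : 'rV[R]_n) (j : 'I_n) :
  (y *m absorbing_mx R Z f) 0 j = y 0 j - (j \notin Z)%:R * y 0 (f j).
Proof.
rewrite mxE; under eq_bigr do rewrite mxE mulrBr.
rewrite sumrB (bigD1 j) //= eqxx mulr1 big1 => [|i /negPf->]; last exact: mulr0.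
rewrite addr0; congr (_ - _); case: (j \notin Z) => /=; last first.
  by rewrite mul0r big1 // => i _; rewrite mulr0.
rewrite mul1r (bigD1 (f j)) //= eqxx mulr1 big1 ?addr0 // => i /negPf->.
exact: mulr0.
Qed.

(* If every point is absorbed, a nontrivial permutation in the Leibniz formula
   would follow [f] forever without meeting [Z]; otherwise the indicator of the
   points that never meet [Z] is a left kernel vector. *)
Lemma det_absorbing_mx (R : comNzRingType) (n : nat) (Z : {set 'I_n})
    (f : 'I_n -> 'I_n) :
  \det (absorbing_mx R Z f) = (absorbing Z f)%:R.
Proof.
have [/forallP fZ|nfZ] := boolP (absorbing Z f); last first.
  have [u bu] := existsP (etrans (esym (negb_forall _)) nfZ).
  pose y : 'rV[R]_n := \row_v (~~ meets Z f v)%:R.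
  have y0 : y *m absorbing_mx R Z f = 0.
    apply/rowP => j; rewrite absorbing_mx_row !mxE meets_step negb_or.
    by case: (j \notin Z); rewrite /= ?mul1r ?mul0r ?subrr ?subr0.
  have := congr1 (mulmx^~ (\adj (absorbing_mx R Z f))) y0.
  rewrite -mulmxA mul_mx_adj mul0mx mul_mx_scalar => /rowP/(_ u).
  by rewrite !mxE bu mulr1.
rewrite /determinant (bigD1 1%g) //= odd_perm1 mul1r.
rewrite [X in _ + X]big1 ?addr0 => [|s ns1].
  (* A point fixed by [f] is absorbed only if it lies in [Z], so all diagonal entries are 1. *)
  apply: big1 => i _; rewrite mxE perm1 eqxx.
  case: eqP => [fi|]; last by rewrite andbF subr0.
  have /meetsP[k] := fZ i; rewrite iter_fix // => ->.
  by rewrite subr0.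
suff [j Aj] : exists j, absorbing_mx R Z f ((s^-1)%g j) j = 0.
  by rewrite (bigD1 ((s^-1)%g j)) //= permKV Aj mul0r mulr0.
apply/exists_eqP; apply: contraT => /existsPn nA.
have [u su] : exists u, (s^-1)%g u != u.
  apply/existsP; apply: contraT => /existsPn s1.
  case/negP: ns1; rewrite -eq_invg1; apply/eqP/permP => u.
  by rewrite perm1; apply/eqP/negPn/s1.
have step v : (s^-1)%g v != v -> (v \notin Z) && ((s^-1)%g v == f v).
  move=> sv; have := nA v; rewrite mxE (negPf sv) sub0r oppr_eq0.
  by case: (_ && _) => //; rewrite eqxx.
have /meetsP[k kZ] := fZ u.
suff : (s^-1)%g (iter k f u) != iter k f u by case/step/andP; rewrite kZ.
elim: k {kZ} => //= k IH; have /andP[_ /eqP fk] := step _ IH.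
by rewrite -fk (inj_eq perm_inj).
Qed.

(** Adding all rows to row [k] clears that row outside column [k]. The determinant thus depends on
    column [k] only through its sum. *)
Lemma det_colsum0 (R : comNzRingType) (n : nat) (X : 'M[R]_n) (k : 'I_n) :
    (forall j, j != k -> \sum_i X i j = 0) ->
  \det X = (\sum_i X i k) * cofactor X k k.
Proof.
move=> X0.
have : const_mx 1 *m X = (\sum_i X i k) *: delta_mx 0 k :> 'rV_n.
  apply/rowP => j; rewrite !mxE; under eq_bigr do rewrite mxE mul1r.
  by have [->|/X0->] := eqVneq j k; rewrite ?mulr1 ?mulr0.
move/(congr1 (mulmx^~ (\adj X))); rewrite -mulmxA mul_mx_adj -scalemxAl -rowE.
by rewrite mul_mx_scalar => /rowP/(_ k); rewrite !mxE mulr1.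
Qed.

Lemma sum_mul_delta (R : pzRingType) (T : finType) (F : T -> R) (x : T) :
  \sum_v F v * (v == x)%:R = F x.
Proof.
rewrite (bigD1 x) //= eqxx mulr1 big1 ?addr0 // => v /negPf->.
exact: mulr0.
Qed.

Lemma sum_delta (R : pzRingType) (T : finType) (x : T) :
  \sum_v (v == x)%:R = 1 :> R.
Proof. by rewrite (bigD1 x) //= eqxx big1 ?addr0 // => v /negPf->. Qed.

(** * Signature entries as determinants in ambient coordinates *)

Definition root_coord (n : nat) (r : posroot n) (i : 'I_n.+1) : int :=
  (i == (val r).1)%:R - (i == (val r).2)%:R.

Lemma sum_root_coord (n : nat) (r : posroot n) : \sum_i root_coord r i = 0.
Proof. by rewrite sumrB !sum_delta subrr. Qed.

(** The omitted root is replaced by the basis vector at [w]. The determinant is the same for every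
    [w], which leaves [w] free to suit each application. *)
Definition punctured_mx (n : nat) (t : n.+1.-tuple (posroot n))
    (k w : 'I_n.+1) : 'M[int]_n.+1 :=
  \matrix_(i, j) (if j == k then (i == w)%:R else root_coord (tnth t j) i).

Lemma det_punctured_mx (n : nat) (t : n.+1.-tuple (posroot n))
    (k w : 'I_n.+1) :
  \det (punctured_mx t k w) = cofactor (punctured_mx t k w) k k.
Proof.
rewrite (@det_colsum0 _ _ _ k) => [|j /negPf jk].
  under eq_bigr do rewrite mxE eqxx.
  by rewrite sum_delta mul1r.
under eq_bigr do rewrite mxE jk.
exact: sum_root_coord.
Qed.

(* Coordinates on the simple roots are partial sums of the ambient coordinates,
   so the two matrices differ by a triangular factor of determinant [+-1]. *)
Lemma omit_detE (n : nat) (t : n.+1.-tuple (posroot n)) (k w : 'I_n.+1) :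
  omit_det t k = (-1) ^+ n.+1 * \det (punctured_mx t k w).
Proof.
(* Column [k] keeps its root and gains the basis vector at [ord0], which only the row of ones of [L]
   detects. The other rows of [L] take negated tail sums; these are the initial sums, since the
   coordinates of a root add up to zero. *)
pose X := \matrix_(i < n.+1, j < n.+1)
  (root_coord (tnth t j) i + (j == k)%:R * (i == ord0)%:R).
pose L := \matrix_(i < n.+1, v < n.+1)
  oapp (fun l : 'I_n => - (l < v)%N%:R) (1 : int) (unlift ord0 i).
have detL : \det L = (-1) ^+ n.
  rewrite -det_tr det_trig => [|].
    rewrite big_ord_recl !mxE unlift_none mul1r.
    under eq_bigr do rewrite !mxE liftK /= /bump /= add1n ltnSn.
    by rewrite prodr_const card_ord.
  apply/is_trig_mxP => i j ij; rewrite !mxE.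
  case: unliftP ij => [l ->|->] //=.
  by rewrite /bump /= add1n ltnS leqNgt => /negPf->; rewrite oppr0.
have detX : \det X = \det (punctured_mx t k w).
  rewrite det_punctured_mx (@det_colsum0 _ _ _ k) => [|j /negPf jk].
    under eq_bigr do rewrite mxE eqxx mul1r.
    rewrite big_split /= sum_root_coord add0r sum_delta mul1r.
    congr (_ * \det _); apply/matrixP => i j; rewrite !mxE.
    by rewrite [_ == k]eq_sym (negPf (neq_lift _ _)) mul0r addr0.
  under eq_bigr do rewrite mxE jk mul0r addr0.
  exact: sum_root_coord.
rewrite omit_det_cofactor exprS mulN1r mulNr -detL -detX -det_mulmx.
congr (- \det _); apply/matrixP => i j; rewrite !mxE.
under eq_bigr do rewrite !mxE.
case: unliftP => [l _|_] /=; last first.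
  under eq_bigr do rewrite mul1r.
  by rewrite big_split /= -mulr_sumr sum_delta sum_root_coord add0r mulr1.
under eq_bigr do rewrite mulrDr mulrBr mulrCA.
rewrite big_split sumrB /= -mulr_sumr !sum_mul_delta /= oppr0 mulr0 addr0.
rewrite /root_coef; case: (tnth t j) => -[x y] /= xy.
case: (leqP x l) => [_|lx] /=; first by rewrite oppr0 sub0r opprK; case: ltnP.
by rewrite (ltn_trans lx xy) opprK addNr.
Qed.

(** * The signature of the edges of a self-map *)

(** This set is empty when [f] has several cycles, so being nonempty encodes that the cycle is
    unique. *)
Definition recurrent (T : finType) (f : T -> T) : {set T} :=
  [set v | [forall u, fconnect f u v]].

Lemma recurrentP (T : finType) (f : T -> T) (v : T) :
  reflect (forall u, fconnect f u v) (v \in recurrent f).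
Proof. by rewrite inE; apply: forallP. Qed.

Lemma absorbing_set1 (T : finType) (f : T -> T) (v : T) :
  absorbing [set v] f = (v \in recurrent f).
Proof.
rewrite inE; apply: eq_forallb => u; apply/exists_inP/idP => [[z /set1P->]|uv] //.
by exists v; rewrite ?set11.
Qed.

Definition ups (n : nat) (f : 'I_n -> 'I_n) : nat :=
  #|[set v in recurrent f | (v < f v)%N]|.

Definition downs (n : nat) (f : 'I_n -> 'I_n) : nat :=
  #|[set v in recurrent f | (f v < v)%N]|.

Definition edge_of (n : nat) (f : 'I_n.+1 -> 'I_n.+1) (v : 'I_n.+1)
    (r : posroot n) : bool :=
  (val r == (v, f v)) || (val r == (f v, v)).

Definition dir_sign (n : nat) (f : 'I_n -> 'I_n) (v : 'I_n) : int :=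
  if (v < f v)%N then 1 else -1.

Lemma edge_of_neq (n : nat) (f : 'I_n.+1 -> 'I_n.+1) (v : 'I_n.+1)
    (r : posroot n) :
  edge_of f v r -> f v != v.
Proof.
case: r => -[x y] xy; rewrite /edge_of /= => /orP[]/eqP[] ? ?; subst x y.
  by rewrite -val_eqE /= gtn_eqF.
by rewrite -val_eqE /= ltn_eqF.
Qed.

Lemma root_coord_edge_of (n : nat) (f : 'I_n.+1 -> 'I_n.+1) (v i : 'I_n.+1)
    (r : posroot n) :
  edge_of f v r ->
  root_coord r i = dir_sign f v * ((i == v)%:R - (i == f v)%:R).
Proof.
rewrite /root_coord /dir_sign.
case: r => -[x y] xy; rewrite /edge_of /= => /orP[]/eqP[] ? ?; subst x y.
  by rewrite xy mul1r.
by rewrite ltnNge (ltnW xy) /= mulN1r opprB.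
Qed.

(** Up to column signs, [punctured_mx t k k] is [absorbing_mx] for the single point [k], whose
    determinant tests whether [k] is recurrent. Signs are their own inverses, so the product over
    [j != k] is the full product times the sign at [k]; the full product goes into [b]. *)
Lemma omit_det_edge_of (n : nat) (f : 'I_n.+1 -> 'I_n.+1)
    (t : n.+1.-tuple (posroot n)) :
    (forall v, edge_of f v (tnth t v)) ->
  exists b : bool, forall k,
    omit_det t k = (-1) ^+ b * dir_sign f k * (k \in recurrent f)%:R.
Proof.
move=> ft.
have signE v : dir_sign f v = (-1) ^+ (~~ (v < f v)%N).
  by rewrite /dir_sign; case: ltnP.
have [b bE] : exists b : bool,
    (-1) ^+ n.+1 * \prod_j dir_sign f j = (-1) ^+ b.
  under eq_bigr do rewrite signE.
  by rewrite -expr_sum -exprD -signr_odd; eexists.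
exists b => k; rewrite (omit_detE _ _ k) -bE -absorbing_set1.
rewrite -det_absorbing_mx -mulrA -mulrA; congr (_ * _).
pose d : 'rV[int]_n.+1 := \row_j (if j == k then 1 else dir_sign f j).
have -> : punctured_mx t k k = absorbing_mx _ [set k] f *m diag_mx d.
  apply/matrixP => i j; rewrite mul_mx_diag !mxE inE.
  have [->|_] := eqVneq j k; first by rewrite subr0 mulr1.
  by rewrite (root_coord_edge_of _ (ft j)) mulrC.
rewrite det_mulmx mulrC mulrA det_diag; congr (_ * _).
rewrite [in RHS](bigD1 k) //= [RHS]mulrC signE signrMK.
rewrite (bigD1 k) //= mxE eqxx mul1r.
by apply: eq_bigr => j /negPf jk; rewrite mxE jk.
Qed.

Lemma signature_edge_of (n : nat) (f : 'I_n.+1 -> 'I_n.+1)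
    (t : n.+1.-tuple (posroot n)) :
    (forall v, edge_of f v (tnth t v)) ->
  perm_eq (signature t) [:: downs f; ups f].
Proof.
move=> ft; have [b tE] := omit_det_edge_of ft.
have upsE : #|[set k | dir_sign f k * (k \in recurrent f)%:R == 1]| = ups f.
  apply: eq_card => k; rewrite !inE /dir_sign.
  by case: (_ < _)%N; case: [forall _, _].
have downsE : #|[set k | dir_sign f k * (k \in recurrent f)%:R == -1]| = downs f.
  apply: eq_card => k; rewrite !inE /dir_sign.
  (* [dir_sign] is -1 at a fixed point too; the edge at [k] excludes this case. *)
  have := edge_of_neq (ft k); rewrite -val_eqE neq_ltn /=.
  by case: (ltngtP k (f k)); case: [forall _, _].
have cardE (c : int) : #|[set k | omit_det t k == c]| =
    #|[set k | dir_sign f k * (k \in recurrent f)%:R == (-1) ^+ b * c]|.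
  apply: eq_card => k; rewrite [LHS]in_set [RHS]in_set tE -mulrA.
  by apply/eqP/eqP => [<-|->]; rewrite signrMK.
rewrite /signature !cardE -upsE -downsE.
case: b {tE cardE}; first by rewrite expr1 !mulN1r opprK.
by rewrite expr0 !mul1r (perm_catC [:: _] [:: _]).
Qed.

(** * Sets of roots that come from a self-map *)

Definition edge_set (n : nat) (f : 'I_n.+1 -> 'I_n.+1) : {set posroot n} :=
  [set r | [exists v, edge_of f v r]].

(** Fixed points are excluded as well. Hence every [{v, f v}] is an edge, and different vertices
    give different edges. *)
Definition no_2cycle (T : finType) (f : T -> T) : bool :=
  [forall v, f (f v) != v].

Lemma no_2cycle_neq (T : finType) (f : T -> T) (v : T) :
  no_2cycle f -> f v != v.
Proof. by move/forallP/(_ v); apply: contraNneq => fv; rewrite !fv. Qed.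

Lemma edge_of_inj (n : nat) (f : 'I_n.+1 -> 'I_n.+1) (v : 'I_n.+1)
    (r r' : posroot n) :
  edge_of f v r -> edge_of f v r' -> r = r'.
Proof.
case: r r' => -[x y] /= xy [[x' y'] /= xy'].
rewrite /edge_of /= => fr fr'; apply: val_inj => /=; move: fr fr' xy xy'.
by move=> /orP[]/eqP[-> ->] /orP[]/eqP[-> ->] // a /(ltn_trans a); rewrite ltnn.
Qed.

Lemma edge_of_share (n : nat) (f g : 'I_n.+1 -> 'I_n.+1) (u v : 'I_n.+1)
    (r : posroot n) :
  edge_of f u r -> edge_of g v r ->
  u = v /\ f u = g v \/ f u = v /\ g v = u.
Proof.
case: r => -[x y] xy; rewrite /edge_of /=.
by move=> /orP[]/eqP[-> ->] /orP[]/eqP[-> ->]; auto.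
Qed.

Lemma edge_ofP (n : nat) (f : 'I_n.+1 -> 'I_n.+1) (v : 'I_n.+1) :
  f v != v -> exists r, edge_of f v r.
Proof.
rewrite -val_eqE neq_ltn /= => /orP[fv|vf].
  by exists (exist _ (f v, v) fv); rewrite /edge_of /= eqxx orbT.
by exists (exist _ (v, f v) vf); rewrite /edge_of /= eqxx.
Qed.

Lemma edge_tuple (n : nat) (f : 'I_n.+1 -> 'I_n.+1) :
    no_2cycle f ->
  exists t : n.+1.-tuple (posroot n), forall v, edge_of f v (tnth t v).
Proof.
move=> f2; have [r rE] := fin_all_exists (fun v => edge_ofP (no_2cycle_neq v f2)).
by exists [tuple r i | i < n.+1] => v; rewrite tnth_mktuple.
Qed.

Lemma is_ordering_edge_set (n : nat) (f : 'I_n.+1 -> 'I_n.+1)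
    (t : n.+1.-tuple (posroot n)) :
    no_2cycle f -> (forall v, edge_of f v (tnth t v)) ->
  is_ordering (edge_set f) t.
Proof.
move=> f2 ft; apply/andP; split.
  apply/tuple_uniqP => u v uv; have := ft v; rewrite -uv.
  case/(edge_of_share (ft u)) => [[]//|[fu fv]].
  by have /forallP/(_ u) := f2; rewrite fu fv eqxx.
apply/eqP/setP => r; rewrite !inE; apply/tnthP/existsP => [[v ->]|[v vr]].
  by exists v.
by exists v; apply: edge_of_inj vr (ft v).
Qed.

Lemma has_sign_edge_set (n : nat) (f : 'I_n.+1 -> 'I_n.+1) (a b : nat) :
    no_2cycle f ->
  has_sign (edge_set f) a b = perm_eq [:: downs f; ups f] [:: a; b].
Proof.
move=> f2; have [t ft] := edge_tuple f2.
have ot := is_ordering_edge_set f2 ft; have st := signature_edge_of ft.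
apply/existsP/idP => [[u /andP[ou su]]|fab].
  by rewrite -(permPl st) (permPl (signature_ordering ot ou)).
by exists t; rewrite ot (permPl st).
Qed.

(* The Leibniz formula for a nonvanishing minor matches every vertex with an
   edge containing it; [f] sends the vertex to the other end of that edge. *)
Lemma has_sign_edge_set_ex (n : nat) (S : {set posroot n}) (a b : nat) :
    (0 < a)%N -> has_sign S a b ->
  exists2 f : {ffun 'I_n.+1 -> 'I_n.+1}, no_2cycle f & edge_set f = S.
Proof.
move=> a0 /existsP[t /andP[/andP[ut /eqP tS] tab]].
have [k tk] : exists k, omit_det t k != 0.
  have /perm_mem/(_ a) := tab; rewrite !inE eqxx => /orP[]/eqP Ea;
    move: a0; rewrite Ea card_gt0 => /set0Pn[k]; rewrite inE => /eqP tk;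
    by exists k; rewrite tk.
(* With [w] an end of the omitted edge, the vertex matched with column [k] also lies on its edge. *)
pose w := (val (tnth t k)).1.
have [s sP] : exists s : 'S_n.+1, forall i,
    i \in [:: (val (tnth t (s i))).1; (val (tnth t (s i))).2].
  move: tk; rewrite (omit_detE _ _ w) mulf_eq0 negb_or => /andP[_].
  have [/existsP[s sP] _|] := boolP [exists s : 'S_n.+1,
      [forall i, punctured_mx t k w i (s i) != 0]].
    exists s => i; have /forallP/(_ i) := sP; rewrite mxE !inE.
    have [->|_] := eqVneq (s i) k; first by rewrite -/w; case: (i == w).
    rewrite /root_coord; apply: contraNT; rewrite negb_or.
    by case/andP=> /negPf-> /negPf->.
  move=> /existsPn ns /eqP[]; rewrite /determinant; apply: big1 => s _.
  have /forallPn[i] := ns s; rewrite negbK => /eqP i0.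
  by rewrite (bigD1 i) //= i0 mul0r mulr0.
pose r i := tnth t (s i).
pose f := [ffun i => if i == (val (r i)).1 then (val (r i)).2 else (val (r i)).1].
have fr i : edge_of f i (r i).
  rewrite /edge_of ffunE; have := sP i; rewrite !inE -/(r i).
  case: (r i) => -[x y] /= _; case: (i =P x) => [->|_ /= /eqP->].
    by rewrite eqxx.
  by rewrite eqxx orbT.
have r_inj : injective r by move=> i j /(tuple_uniqP _ ut)/perm_inj.
exists f.
  (* If [f (f i) = i], then [i] and [f i] are matched with the same edge, against injectivity of
     [r]. *)
  apply/forallP => i; apply/eqP => ffi; have fi := edge_of_neq (fr i).
  case/eqP: fi; apply: r_inj; apply: (@edge_of_inj _ f i) => //.
  by have := fr (f i); rewrite /edge_of ffi orbC.
apply/setP => x; rewrite -tS !inE; apply/existsP/tnthP => [[i ix]|[i ->]].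
  by exists (s i); apply: edge_of_inj ix (fr i).
by exists ((s^-1)%g i); have := fr ((s^-1)%g i); rewrite /r permKV.
Qed.

(** * Counting the ways to attach the other vertices *)

(* The matrix determinant lemma, cleared of denominators. *)
Lemma det_rank1_update (R : comNzRingType) (n : nat) (D : 'M[R]_n)
    (u w : 'cV[R]_n) (v : 'rV[R]_n) (a : R) :
  D *m w = a *: u -> a * \det (D - u *m v) = (a - (v *m w) 0 0) * \det D.
Proof.
move=> Dw.
(* One bordered matrix is factored in two ways, and the determinants are compared. *)
have E1 : block_mx 1%:M 0 u 1%:M *m block_mx 1%:M v 0 (D - u *m v) *m
    block_mx a%:M 0 0 1%:M = block_mx a%:M v (a *: u) D :> 'M_(1 + n).
  rewrite !mulmx_block !(mul1mx, mulmx1, mul0mx, mulmx0, addr0, add0r).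
  by rewrite mul_mx_scalar addrC subrK.
have E2 : block_mx (a%:M - v *m w) v 0 D *m block_mx 1%:M 0 w 1%:M
    = block_mx a%:M v (a *: u) D :> 'M_(1 + n).
  by rewrite !mulmx_block !(mul1mx, mulmx1, mul0mx, mulmx0, addr0, add0r) subrK Dw.
have := congr1 determinant (etrans E1 (esym E2)).
rewrite !det_mulmx !det_lblock !det_ublock !det1 !det_mx11 !mxE eqxx.
by rewrite !mul1r !mulr1 mulrC.
Qed.

(** Column [j] depends on [f] only through [f j], so multilinearity merges the independent
    choices. *)
Lemma sum_det_family (R : comNzRingType) (n : nat) (Q : 'I_n -> pred 'I_n)
    (F : 'I_n -> 'I_n -> 'I_n -> R) :
  \sum_(f : {ffun 'I_n -> 'I_n} | f \in family Q) \det (\matrix_(i, j) F i j (f j)) =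
  \det (\matrix_(i, j) \sum_(x | Q j x) F i j x).
Proof.
rewrite -[RHS]det_tr.
transitivity (\sum_(f : {ffun 'I_n -> 'I_n} | f \in family Q)
    \sum_(s : 'S_n) (-1) ^+ s * \prod_i F (s i) i (f i)).
  apply: eq_bigr => f _; rewrite -det_tr; apply: eq_bigr => s _; congr (_ * _).
  by apply: eq_bigr => i _; rewrite !mxE.
rewrite exchange_big; apply: eq_bigr => s _ /=; rewrite -mulr_sumr.
congr (_ * _); under [RHS]eq_bigr do rewrite !mxE.
by rewrite bigA_distr_big_dep.
Qed.

Lemma det_absorbing_sum (n : nat) (Z : {set 'I_n}) :
  n%:R * \det (\matrix_(i < n, j < n)
      (if j \in Z then (i == j)%:R else n%:R * (i == j)%:R - 1) : 'M[int]_n) =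
  #|Z|%:R * n%:R ^+ (n - #|Z|).
Proof.
pose d : 'rV[int]_n := \row_j (if j \in Z then 1 else n%:R).
pose y : 'rV[int]_n := \row_j (j \notin Z)%:R.
(* This [w] makes [diag_mx d *m w] the constant vector [n], as the rank one update requires with
   [a = n]. *)
pose w : 'cV[int]_n := \col_j (if j \in Z then n%:R else 1).
rewrite [X in \det X](_ : _ = diag_mx d - const_mx 1 *m y); last first.
  apply/matrixP => i j; rewrite !mxE big_ord1 !mxE mul1r.
  have [->|ij] := eqVneq i j; case: (j \in Z) => /=;
    by rewrite ?subr0 ?mulr1 ?mulr0.
rewrite (@det_rank1_update _ _ _ _ w); last first.
  apply/colP => i; rewrite mul_diag_mx !mxE.
  by case: (i \in Z); rewrite ?mulr1 ?mul1r.
have cZ : #|~: Z| = (n - #|Z|)%N by rewrite cardsCs setCK card_ord.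
have -> : (y *m w) 0 0 = (n - #|Z|)%:R.
  rewrite mxE -cZ -sum1_card natr_sum [RHS]big_mkcond; apply: eq_bigr => j _.
  by rewrite !mxE inE; case: (j \in Z); rewrite ?mul0r ?mul1r.
have Zn : (#|Z| <= n)%N by rewrite -[n in (_ <= n)%N]card_ord max_card.
rewrite natrB // subKr det_diag -cZ -prodr_const; congr (_ * _).
rewrite [RHS]big_mkcond; apply: eq_bigr => j _; rewrite mxE inE.
by case: (j \in Z).
Qed.

(** Outside [Z] such maps are the forests rooted at [Z], so this is Cayley's formula, multiplied by
    [n] to keep the exponent natural when [Z] is everything. *)
Lemma card_absorbing (n : nat) (Z : {set 'I_n}) (g : 'I_n -> 'I_n) :
  (n * #|[set f : {ffun 'I_n -> 'I_n} |
      absorbing Z f && [forall z in Z, f z == g z]]|)%N =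
  (#|Z| * n ^ (n - #|Z|))%N.
Proof.
apply/eqP; rewrite -(eqr_nat int) !natrM natrX -det_absorbing_sum.
apply/eqP; congr (_ * _).
pose Q (j : 'I_n) : pred 'I_n := fun x => (j \in Z) ==> (x == g j).
transitivity (\sum_(f : {ffun 'I_n -> 'I_n} | f \in family Q)
    \det (absorbing_mx int Z f)).
  rewrite -sum1_card natr_sum [RHS]big_mkcond [LHS]big_mkcond.
  apply: eq_bigr => f _; rewrite inE det_absorbing_mx andbC.
  have -> : [forall z in Z, f z == g z] = (f \in family Q) by [].
  by case: (f \in family Q); case: absorbing.
rewrite (sum_det_family Q
  (fun i j x => (i == j)%:R - ((j \notin Z) && (i == x))%:R)).
congr (\det _); apply/matrixP => i j; rewrite !mxE /Q.
case: (j \in Z) => /=; first by rewrite big_pred1_eq subr0.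
rewrite sumrB sumr_const card_ord mulr_natl; congr (_ - _).
by under eq_bigr do rewrite eq_sym; rewrite sum_delta.
Qed.

End Determinants.

(** * Reversing the cycle, and the maps with a given edge set *)

Lemma recurrent_connect (T : finType) (f : T -> T) (v w : T) :
  v \in recurrent f -> fconnect f v w -> w \in recurrent f.
Proof.
by move=> /recurrentP fv vw; apply/recurrentP => u; apply: connect_trans (fv u) vw.
Qed.

Lemma recurrent_stable (T : finType) (f : T -> T) :
  {homo f : v / v \in recurrent f}.
Proof. by move=> v /recurrent_connect; apply; apply: fconnect1. Qed.

Lemma recurrent_pre (T : finType) (f : T -> T) (v : T) :
  v \in recurrent f -> exists2 w, w \in recurrent f & f w = v.
Proof.
move=> fv; have /recurrentP/(_ (f v)) := fv.
move=> /iter_findex; set k := findex _ _ _ => kv.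
exists (iter k f v); last by rewrite -iterS iterSr.
exact: recurrent_connect (fconnect_iter _ _ _).
Qed.

(** By [recurrent_pre], [f] maps this finite set onto itself. *)
Lemma recurrent_inj (T : finType) (f : T -> T) :
  {in recurrent f &, injective f}.
Proof.
apply/imset_injP; apply/eqP; congr #|pred_of_set _|; apply/eqP.
rewrite eqEsubset; apply/andP; split.
  by apply/subsetP => _ /imsetP[v fv ->]; apply: recurrent_stable.
by apply/subsetP => v /recurrent_pre[w fw <-]; apply: imset_f.
Qed.

(** The cycle is walked backwards and the other points keep their images. [recurrent_pre] guarantees
    that [pick] succeeds on the cycle. *)
Definition reverse (T : finType) (f : T -> T) : {ffun T -> T} :=
  [ffun v => if v \in recurrent f
             then odflt v [pick w in recurrent f | f w == v] else f v].

Lemma reverse_notin (T : finType) (f : T -> T) (v : T) :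
  v \notin recurrent f -> reverse f v = f v.
Proof. by rewrite ffunE => /negPf->. Qed.

Lemma reverse_in (T : finType) (f : T -> T) (v : T) :
  v \in recurrent f -> reverse f v \in recurrent f /\ f (reverse f v) = v.
Proof.
move=> fv; rewrite ffunE fv; case: pickP => [w /andP[fw /eqP]//|nw].
by have [w fw wv] := recurrent_pre fv; have := nw w; rewrite fw wv eqxx.
Qed.

Lemma reverse_no_2cycle (T : finType) (f : T -> T) :
  no_2cycle f -> no_2cycle (reverse f).
Proof.
move=> /forallP f2; apply/forallP => v.
have [fv|nfv] := boolP (v \in recurrent f).
  have [fw wv] := reverse_in fv; have [_ xw] := reverse_in fw.
  apply: contra (f2 (reverse f (reverse f v))) => /eqP E.
  by rewrite xw wv E.
rewrite (reverse_notin nfv); have [ffv|nffv] := boolP (f v \in recurrent f).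
  by have [fw _] := reverse_in ffv; apply: contraNneq nfv => <-.
by rewrite reverse_notin.
Qed.

Lemma reverse_neq (T : finType) (f : T -> T) (v : T) :
  no_2cycle f -> v \in recurrent f -> reverse f v != f v.
Proof.
move=> /forallP/(_ v) f2 /reverse_in[_ fw].
by apply: contraNneq f2 => <-; rewrite fw.
Qed.

Lemma edge_set_reverse (n : nat) (f : 'I_n.+1 -> 'I_n.+1) :
  edge_set (reverse f) = edge_set f.
Proof.
apply/setP => r; rewrite !inE; apply/existsP/existsP => -[v]; rewrite /edge_of => vr.
  have [fv|nfv] := boolP (v \in recurrent f); last first.
    by exists v; rewrite -(reverse_notin nfv).
  have [fw wv] := reverse_in fv.
  by exists (reverse f v); rewrite wv orbC.
have [fv|nfv] := boolP (v \in recurrent f); last first.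
  by exists v; rewrite (reverse_notin nfv).
have [fw wv] := reverse_in (recurrent_stable fv).
have {}wv : reverse f (f v) = v by apply: (recurrent_inj fw fv wv).
by exists (f v); rewrite wv orbC.
Qed.

(** The edge of [f] at [v] is also the edge of [g] at some vertex; this vertex cannot be [v], so [g]
    traverses the edge backwards. *)
Lemma edge_set_diff (n : nat) (f g : 'I_n.+1 -> 'I_n.+1) (v : 'I_n.+1) :
  no_2cycle f -> edge_set f = edge_set g -> f v != g v -> g (f v) = v.
Proof.
move=> f2 fg fgv; have [r fr] := edge_ofP (no_2cycle_neq v f2).
have : r \in edge_set g by rewrite -fg inE; apply/existsP; exists v.
rewrite inE => /existsP[w gr].
have [[vw fgw]|[<- //]] := edge_of_share fr gr.
by rewrite fgw vw eqxx in fgv.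
Qed.

(** On the set [D] of disagreement [g] inverts [f], so [f] permutes [D], which is therefore a union
    of cycles. A recurrent point leaves only one cycle. *)
Lemma edge_set_recurrent (n : nat) (f g : 'I_n.+1 -> 'I_n.+1) (u z : 'I_n.+1) :
    no_2cycle f -> no_2cycle g -> edge_set f = edge_set g ->
    f u != g u -> z \in recurrent f ->
  forall v, (f v != g v) = (v \in recurrent f).
Proof.
move=> f2 g2 fg fgu fz.
have gfD v : f v != g v -> g (f v) = v by apply: edge_set_diff.
pose D := [set v | f v != g v].
have Df : {homo f : v / v \in D}.
  by move=> v; rewrite !inE => /gfD->; have /forallP/(_ v) := f2.
have f_inj : {in D &, injective f}.
  by move=> x y; rewrite !inE => /gfD {2}<- /gfD {2}<- ->.
have reach v w : v \in D -> fconnect f v w -> w \in D.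
  move=> vD /iter_findex<-; elim: (findex _ _ _) => //= k; exact: Df.
have zD : z \in D by apply: (reach u); [rewrite inE|apply/recurrentP].
move=> v; apply/idP/idP => [fgv|].
  have vD : v \in D by rewrite inE.
  (* As [f] permutes [D], reachability inside [D] is symmetric: [v] reaches [z], hence [z] reaches
     [v]. *)
  apply: (recurrent_connect fz); rewrite (fconnect_sym_in Df f_inj) //.
  exact/recurrentP.
by move/recurrentP/(_ u)/(reach u); rewrite !inE; apply.
Qed.

(** The two maps differ exactly on the cycle of [f], where [edge_set_diff] makes [g] an inverse of
    [f]. *)
Lemma edge_set_fiber (n : nat) (f g : {ffun 'I_n.+1 -> 'I_n.+1})
    (z : 'I_n.+1) :
    no_2cycle f -> no_2cycle g -> edge_set f = edge_set g ->
    z \in recurrent f -> g != f ->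
  g = reverse f.
Proof.
move=> f2 g2 fg fz gf.
have [u fgu] : exists u, f u != g u.
  apply/existsP; apply: contraT => /existsPn fgE; case/eqP: gf.
  by apply/ffunP => v; apply/esym/eqP/negPn/fgE.
have fgE := edge_set_recurrent f2 g2 fg fgu fz.
apply/ffunP => v; have [fv|nfv] := boolP (v \in recurrent f); last first.
  by rewrite reverse_notin //; apply/esym/eqP; rewrite -[_ == _]negbK fgE.
have [fw wv] := reverse_in fv.
have fgv : f (g v) = v.
  by apply: edge_set_diff g2 (esym fg) _; rewrite eq_sym fgE.
have gv : g v \in recurrent f.
  by rewrite -fgE fgv eq_sym; apply: (forallP g2).
by apply: (recurrent_inj gv fw); rewrite fgv wv.
Qed.

Lemma card_inverse_le (T : finType) (D : {set T}) (f g : T -> T) (R : rel T) :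
    (forall v, v \in D -> g v \in D /\ f (g v) = v) ->
  #|[set v in D | R (g v) v]| <= #|[set w in D | R w (f w)]|.
Proof.
move=> gD.
have g_inj : {in [set v in D | R (g v) v] &, injective g}.
  by move=> x y; rewrite !inE => /andP[/gD[_ fx] _] /andP[/gD[_ fy] _] E; rewrite -fx E fy.
rewrite -(card_in_imset g_inj).
apply/subset_leq_card/subsetP => _ /imsetP[v + ->].
rewrite !inE => /andP[vD Rv].
by have [-> ->] := gD v vD.
Qed.

(** Both maps run through one cycle in opposite directions: a descent of [g] from [v] is an ascent
    of [f] into [v]. *)
Lemma downs_swap (n : nat) (f g : 'I_n.+1 -> 'I_n.+1) (u z z' : 'I_n.+1) :
    no_2cycle f -> no_2cycle g -> edge_set f = edge_set g ->
    f u != g u -> z \in recurrent f -> z' \in recurrent g ->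
  downs g = ups f.
Proof.
move=> f2 g2 fg fgu fz gz.
have fE := edge_set_recurrent f2 g2 fg fgu fz.
have guf : g u != f u by rewrite eq_sym.
have gE := edge_set_recurrent g2 f2 (esym fg) guf gz.
have D v : (v \in recurrent g) = (v \in recurrent f) by rewrite -fE -gE eq_sym.
have fD v : v \in recurrent f -> g (f v) = v.
  by rewrite -fE; apply: edge_set_diff.
have gD v : v \in recurrent f -> f (g v) = v.
  by rewrite -D -gE; apply: edge_set_diff.
rewrite /downs /ups (_ : recurrent g = recurrent f); last exact/setP.
apply/eqP; rewrite eqn_leq; apply/andP; split.
  apply: (card_inverse_le (fun x y : 'I_n.+1 => x < y)) => v fv.
  by split; [rewrite -D recurrent_stable ?D | apply: gD].
apply: (card_inverse_le (fun x y : 'I_n.+1 => y < x)) => v fv.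
by split; [apply: recurrent_stable | apply: fD].
Qed.

(** * From sets of roots to self-maps *)

(** The pair is ordered here, unlike in [has_sign]; this is the source of the factor 2 when
    [a = b]. *)
Definition sign_funs (n a b : nat) : {set {ffun 'I_n.+1 -> 'I_n.+1}} :=
  [set f : {ffun 'I_n.+1 -> 'I_n.+1} |
    [&& no_2cycle f, downs f == a & ups f == b]].

Lemma recurrent_ex (n : nat) (f : 'I_n -> 'I_n) :
  0 < downs f -> exists z, z \in recurrent f.
Proof. by rewrite card_gt0 => /set0Pn[z]; rewrite inE => /andP[fz _]; exists z. Qed.

Lemma perm_eq2 (x y a b : nat) :
  perm_eq [:: x; y] [:: a; b] = (x == a) && (y == b) || (x == b) && (y == a).
Proof.
apply/idP/idP => [|/orP[]/andP[/eqP-> /eqP->]]; last 2 first.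
- by [].
- by rewrite (perm_catC [:: _] [:: _]).
move=> E; have /perm_mem/(_ x) := E; rewrite !inE eqxx /= => /esym/orP[]/eqP xE.
  by move: E; rewrite xE perm_cons eqxx => /perm_mem/(_ y); rewrite !inE eqxx => <-.
move: E; rewrite xE perm_sym (perm_catC [:: a] [:: b]) /= perm_cons.
by move/perm_mem/(_ a); rewrite !inE !eqxx (eq_sym y a) => <-; rewrite orbT.
Qed.

Lemma card_edge_set (n : nat) (f : 'I_n.+1 -> 'I_n.+1) :
  no_2cycle f -> #|edge_set f| = n.+1.
Proof.
move=> f2; have [t ft] := edge_tuple f2.
have /andP[ut /eqP <-] := is_ordering_edge_set f2 ft.
by rewrite cardsE (card_uniqP ut) size_tuple.
Qed.

(** Reversing the cycle exchanges [downs] and [ups], so for [a < b] exactly one of the two maps of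
    each set is counted. *)
Lemma s_num_lt (n a b : nat) : 0 < a -> a < b -> s_num n a b = #|sign_funs n a b|.
Proof.
move=> a0 ab; have b0 := ltn_trans a0 ab.
have swap (f g : {ffun 'I_n.+1 -> 'I_n.+1}) :
    no_2cycle f -> no_2cycle g -> edge_set f = edge_set g ->
    0 < downs f -> 0 < downs g -> f != g -> downs g = ups f.
  move=> f2 g2 fg /recurrent_ex[z fz] /recurrent_ex[z' gz] nfg.
  have [u fgu] : exists u, f u != g u.
    apply/existsP; apply: contraT => /existsPn fgE; case/eqP: nfg.
    by apply/ffunP => v; apply/eqP/negPn/fgE.
  exact: downs_swap fgu fz gz.
have e_inj : {in sign_funs n a b &,
    injective (fun f : {ffun 'I_n.+1 -> 'I_n.+1} => edge_set f)}.
  move=> f g; rewrite !inE => /and3P[f2 /eqP fa /eqP fb].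
  move=> /and3P[g2 /eqP ga /eqP gb] fg; apply/eqP; apply: contraT => nfg.
  have := swap f g f2 g2 fg; rewrite fa ga fb => /(_ a0 a0 nfg) E.
  by rewrite E ltnn in ab.
rewrite -(card_in_imset e_inj).
apply: eq_card => S; rewrite inE; apply/andP/imsetP => [[_ hS]|[f]].
  have [f f2 fS] := has_sign_edge_set_ex a0 hS.
  move: hS; rewrite -fS has_sign_edge_set // perm_eq2.
  case/orP=> /andP[fa fb]; first by exists f; rewrite // inE f2 fa fb.
  have df : 0 < downs f by rewrite (eqP fa).
  have [z fz] := recurrent_ex df.
  have r2 := reverse_no_2cycle f2.
  have rf : f != reverse f.
    by apply: contraNneq (reverse_neq f2 fz) => <-.
  have : has_sign (edge_set (reverse f)) a b.
    by rewrite edge_set_reverse has_sign_edge_set // perm_eq2 fa fb orbT.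
  rewrite has_sign_edge_set // perm_eq2 => rab.
  exists (reverse f); last by rewrite edge_set_reverse.
  have dr : 0 < downs (reverse f) by case/orP: rab => /andP[/eqP->].
  move: rab; rewrite inE r2 (swap f (reverse f)) ?edge_set_reverse //.
  by rewrite (eqP fb) eqxx (ltn_eqF ab) /= orbF.
rewrite inE => /and3P[f2 fa fb] ->.
by rewrite card_edge_set // has_sign_edge_set // perm_eq2 fa fb eqxx.
Qed.

(** Both orientations are counted: each fiber of [edge_set] is [{f, reverse f}]. *)
Lemma s_num_eq (n a : nat) : 0 < a -> #|sign_funs n a a| = 2 * s_num n a a.
Proof.
move=> a0; pose e (f : {ffun 'I_n.+1 -> 'I_n.+1}) := edge_set f.
rewrite -sum1_card (partition_big e
  (mem [set S : {set posroot n} | (#|S| == n.+1) && has_sign S a a])) /=; last first.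
  move=> f; rewrite !inE => /and3P[f2 fa fb].
  by rewrite card_edge_set // has_sign_edge_set // perm_eq2 fa fb eqxx.
rewrite /s_num mulnC -sum_nat_const; apply: eq_bigr => S.
rewrite inE => /andP[_ hS]; have [f f2 fS] := has_sign_edge_set_ex a0 hS.
move: (hS); rewrite -fS has_sign_edge_set // perm_eq2 orbb => /andP[fa fb].
have [z fz] : exists z, z \in recurrent f by apply: recurrent_ex; rewrite (eqP fa).
have r2 := reverse_no_2cycle f2.
have rf : f != reverse f by apply: contraNneq (reverse_neq f2 fz) => <-.
rewrite sum1_card.
have <- : #|[set f; reverse f]| = 2 by rewrite cards2 rf.
apply: eq_card => g.
rewrite unfold_in !inE; apply/andP/orP => [[/and3P[g2 _ _] /eqP fg]|].
  have [->|gf] := eqVneq g f; [by left | right].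
  by apply/eqP; apply: edge_set_fiber fz gf.
case=> /eqP->; first by rewrite f2 fa fb eqxx.
rewrite r2 /e edge_set_reverse eqxx; split => //=.
have : has_sign (edge_set (reverse f)) a a by rewrite edge_set_reverse fS.
by rewrite has_sign_edge_set // perm_eq2 orbb.
Qed.

(** * Cyclic orders and permutations *)

Lemma increasing_enum (n m : nat) (Z : {set 'I_n}) :
    #|Z| = m ->
  exists e : 'I_m -> 'I_n,
    [/\ {mono e : i j / i < j}, forall i, e i \in Z
      & forall z, z \in Z -> exists i, e i = z].
Proof.
move=> mZ; subst m; exists (fun i => enum_val i); split; first 2 last.
- move=> z zZ; exists (enum_rank_in zZ z); exact: enum_rankK_in.
- move=> i j /=.
  have lt (k l : 'I_#|Z|) : k < l -> enum_val k < enum_val l.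
    move=> kl; have : sorted ltn (map val (enum Z)).
      apply: (subseq_sorted ltn_trans) (iota_ltn_sorted 0 n).
      by rewrite -val_enum_ord map_subseq // enumT filter_subseq.
    move/(sorted_ltn_nth ltn_trans 0)/(_ k l).
    rewrite !inE size_map -cardE !ltn_ord => /(_ isT isT kl).
    by rewrite !(nth_map (enum_val k)) -?cardE // -!enum_val_nth.
  have [ij|ji|ij] := ltngtP i j; first exact: lt.
    by rewrite ltnNge ltnW // lt.
  by rewrite (ord_inj ij) ltnn.
- exact: enum_valP.
Qed.

Lemma iter_ordS (m : nat) (i : 'I_m.+1) : iter i (@ordS m.+1) ord0 = i.
Proof.
apply: val_inj; case: i => i im /=; elim: i im => //= i IH im.
by rewrite IH ?(ltnW im) // modn_small.
Qed.

Lemma fconnect_ordS (m : nat) (i j : 'I_m.+1) : fconnect (@ordS m.+1) i j.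
Proof.
have h k : fconnect (@ordS m.+1) ord0 k by rewrite -(iter_ordS k) fconnect_iter.
by apply: connect_trans (h j); rewrite fconnect_sym //; apply: ordS_inj.
Qed.

(* The word starts at its maximum, so the step out of it is a descent and the
   closing step back into it is not. *)
Lemma card_cyclic_descents (m : nat) (s : 'S_m) :
    0 < m ->
  #|[set i | lift_perm ord0 ord_max s (ordS i) < lift_perm ord0 ord_max s i]| =
  #|descents s|.+1.
Proof.
move=> m0; set t := lift_perm _ _ s.
have t0 : t ord0 = ord_max by rewrite /t lift_perm_id.
have tl (k : 'I_m) : t (lift ord0 k) = s k :> nat.
  by rewrite /t lift_perm_lift lift_max.
have -> : [set i | t (ordS i) < t i] =
    ord0 |: [set lift ord0 k | k in descents s].
  apply/setP => i; rewrite !inE; case: (unliftP ord0 i) => [k ->|->].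
    rewrite eq_sym (negPf (neq_lift _ _)) /= (mem_imset _ _ (@lift_inj _ _)) inE.
    have [km|mk] := ltnP k.+1 m.
      have -> : ordS (lift ord0 k) = lift ord0 (Ordinal km).
        by apply: val_inj; rewrite /= /bump /= !add1n modn_small.
      rewrite !tl; apply/idP/existsP => [sk|[j /andP[/eqP jk]]].
        by exists (Ordinal km); rewrite eqxx.
      by rewrite (_ : Ordinal km = j) //; apply: val_inj.
    have -> : ordS (lift ord0 k) = ord0.
      apply: val_inj; rewrite /= /bump /= add1n.
      by rewrite (_ : k.+1 = m) ?modnn //; apply/eqP; rewrite eqn_leq mk ltn_ord.
    rewrite t0 ltnNge tl ltnW //=; apply/esym/existsP => -[j /andP[/eqP jk _]].
    by move: (ltn_ord j); rewrite jk ltnNge mk.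
  rewrite eqxx /= t0.
  rewrite (_ : ordS ord0 = lift ord0 (Ordinal m0)).
    by rewrite tl ltn_ord.
  by apply: val_inj; rewrite /= /bump /= addn0 modn_small.
rewrite cardsU1 (card_imset _ (@lift_inj _ _)) (_ : ord0 \notin _) //.
by apply/imsetP => -[k _ /eqP]; rewrite (negPf (neq_lift _ _)).
Qed.

(** Sending all points outside [Z] to [z0] selects one map for each cyclic order of [Z], when [z0]
    lies in [Z]. *)
Definition pointed_cycles (n : nat) (Z : {set 'I_n}) (z0 : 'I_n) (a : nat) :
    {set {ffun 'I_n -> 'I_n}} :=
  [set g : {ffun 'I_n -> 'I_n} | [&& recurrent g == Z,
     [forall v, (v \notin Z) ==> (g v == z0)] & downs g == a]].

Section CycleOfPerm.

Variables (n m : nat) (Z : {set 'I_n}) (e : 'I_m.+1 -> 'I_n).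
Hypothesis e_mono : {mono e : i j / i < j}.
Hypothesis eZ : forall i, e i \in Z.
Hypothesis e_onto : forall z, z \in Z -> exists i, e i = z.
Hypothesis m_gt0 : 0 < m.

Let z0 := e ord_max.

Definition cycle_word (s : 'S_m) (i : 'I_m.+1) : 'I_n :=
  e (lift_perm ord0 ord_max s i).

(** Each letter goes to the cyclically next one. The word exhausts [Z], so the default [z0] is taken
    exactly outside [Z]. *)
Definition cycle_of_perm (s : 'S_m) : {ffun 'I_n -> 'I_n} :=
  [ffun v => oapp (fun i => cycle_word s (ordS i)) z0
                  [pick i | cycle_word s i == v]].

Lemma enum_inj : injective e.
Proof.
move=> i j eij; apply/val_inj/eqP => /=.
by rewrite eqn_leq (leqNgt i) (leqNgt j) -(e_mono i j) -(e_mono j i) eij ltnn.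
Qed.

Lemma cycle_word_inj (s : 'S_m) : injective (cycle_word s).
Proof. by move=> i j /enum_inj/perm_inj. Qed.

Lemma cycle_word_onto (s : 'S_m) (z : 'I_n) :
  z \in Z -> exists i, cycle_word s i = z.
Proof.
move=> /e_onto[i <-]; exists ((lift_perm ord0 ord_max s)^-1%g i).
by rewrite /cycle_word permKV.
Qed.

Lemma cycle_of_permE (s : 'S_m) (i : 'I_m.+1) :
  cycle_of_perm s (cycle_word s i) = cycle_word s (ordS i).
Proof.
rewrite ffunE; case: pickP => [j /eqP/cycle_word_inj-> //|/(_ i)].
by rewrite eqxx.
Qed.

Lemma iter_cycle_of_perm (s : 'S_m) (k : nat) (i : 'I_m.+1) :
  iter k (cycle_of_perm s) (cycle_word s i) =
  cycle_word s (iter k (@ordS m.+1) i).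
Proof. by elim: k => //= k ->; apply: cycle_of_permE. Qed.

Lemma cycle_of_perm_notin (s : 'S_m) (v : 'I_n) :
  v \notin Z -> cycle_of_perm s v = z0.
Proof.
move=> vZ; rewrite ffunE; case: pickP => //= i /eqP iv.
by rewrite -iv eZ in vZ.
Qed.

Lemma recurrent_cycle_of_perm (s : 'S_m) : recurrent (cycle_of_perm s) = Z.
Proof.
have conn i j : fconnect (cycle_of_perm s) (cycle_word s i) (cycle_word s j).
  by rewrite -(iter_findex (fconnect_ordS i j)) -iter_cycle_of_perm fconnect_iter.
apply/setP => v; apply/idP/idP => [/recurrentP/(_ z0)|vZ].
  have [i <-] := @cycle_word_onto s z0 (eZ ord_max).
  by move=> /iter_findex<-; rewrite iter_cycle_of_perm eZ.
have [j <-] := cycle_word_onto s vZ.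
apply/recurrentP => u; have [uZ|nuZ] := boolP (u \in Z).
  by have [i <-] := cycle_word_onto s uZ.
apply: connect_trans (fconnect1 _ u) _; rewrite cycle_of_perm_notin //.
by have [i <-] := @cycle_word_onto s z0 (eZ ord_max).
Qed.

Lemma downs_cycle_of_perm (s : 'S_m) :
  downs (cycle_of_perm s) = #|descents s|.+1.
Proof.
rewrite -(card_cyclic_descents s m_gt0).
rewrite -(card_imset _ (@cycle_word_inj s)) /downs recurrent_cycle_of_perm.
apply: eq_card => v; rewrite inE; apply/andP/imsetP => [[vZ]|[i + ->]].
  have [i <-] := cycle_word_onto s vZ; rewrite cycle_of_permE => lt.
  by exists i; rewrite // inE -e_mono.
by rewrite inE cycle_of_permE /cycle_word e_mono eZ.
Qed.

(** All words start at [z0], so iterating the map from [z0] spells out the word. *)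
Lemma cycle_of_perm_inj : injective cycle_of_perm.
Proof.
move=> s s' E; have w0 x : cycle_word x ord0 = z0.
  by rewrite /cycle_word lift_perm_id.
have wE i : cycle_word s i = cycle_word s' i.
  rewrite -(iter_ordS i) -!iter_cycle_of_perm !w0.
  by rewrite E.
apply/permP => k; have /enum_inj := wE (lift ord0 k).
by rewrite !lift_perm_lift => /lift_inj.
Qed.

Lemma cycle_of_perm_onto (g : {ffun 'I_n -> 'I_n}) :
    recurrent g = Z -> (forall v, v \notin Z -> g v = z0) ->
  exists s, cycle_of_perm s = g.
Proof.
move=> gZ g0; have z0Z : z0 \in Z by apply: eZ.
have Zg : {homo g : v / v \in Z} by rewrite -gZ; apply: recurrent_stable.
have g_inj : {in Z &, injective g} by rewrite -gZ; apply: recurrent_inj.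
have iterZ k : iter k g z0 \in Z by elim: k => //= k; apply: Zg.
(* The orbit of [z0] is all of [Z], so its first [m.+1] iterates are distinct and form the word
   sought. *)
have ord_g : fingraph.order g z0 = m.+1.
  rewrite /fingraph.order -[m.+1]card_ord -(card_imset _ enum_inj); apply: eq_card => v.
  apply/idP/imsetP => [/iter_findex<-|[i _ ->]].
    by have [i <-] := e_onto (iterZ (findex g z0 v)); exists i.
  by have := eZ i; rewrite -gZ => /recurrentP/(_ z0).
have [t tE] := fin_all_exists (fun i : 'I_m.+1 => e_onto (iterZ i)).
have t_inj : injective t.
  move=> i j tij; apply: val_inj => /=.
  rewrite -(@findex_iter _ g z0 i) ?ord_g // -(@findex_iter _ g z0 j) ?ord_g //.
  by rewrite -!tE tij.
have t0 : t ord0 = ord_max by apply: enum_inj; rewrite tE.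
(* Only position [ord0] holds the maximum; removing it from positions and values leaves a
   permutation of ['I_m]. *)
have lt k : exists j, lift ord_max j = t (lift ord0 k).
  case: (unliftP ord_max (t (lift ord0 k))) => [j ->|]; first by exists j.
  by rewrite -t0 => /t_inj/eqP; rewrite eq_sym (negPf (neq_lift _ _)).
have [p pE] := fin_all_exists lt.
have p_inj : injective p.
  by move=> i j pij; apply: (@lift_inj _ ord0); apply: t_inj; rewrite -!pE pij.
exists (perm p_inj).
have wE i : cycle_word (perm p_inj) i = iter i g z0.
  rewrite -tE /cycle_word; congr (e _); case: (unliftP ord0 i) => [k ->|->].
    by rewrite lift_perm_lift permE.
  by rewrite lift_perm_id.
apply/ffunP => v; have [vZ|nvZ] := boolP (v \in Z); last first.
  by rewrite cycle_of_perm_notin // g0.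
have [i <-] := cycle_word_onto (perm p_inj) vZ.
rewrite cycle_of_permE !wE -[RHS]iterS [val _]/=.
have [im|mi] := ltnP i.+1 m.+1; first by rewrite modn_small.
have im : val i = m by apply/eqP; rewrite eqn_leq -ltnS ltn_ord.
(* At the last letter [ordS] wraps around, as does the orbit. *)
have iter_m : iter m.+1 g z0 = z0 by rewrite -[m.+1]ord_g (iter_order_in Zg g_inj).
by rewrite im modnn iter_m.
Qed.

Lemma card_pointed_cycles (a : nat) :
  #|pointed_cycles Z z0 a.+1| = eulerian m a.
Proof.
rewrite /eulerian -(card_imset _ cycle_of_perm_inj); apply: eq_card => g.
rewrite inE; apply/and3P/imsetP => [[/eqP gZ /forallP g0 da]|[s + ->]].
  have [v vZ|s sg] := cycle_of_perm_onto gZ; first by apply/eqP/(implyP (g0 v)).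
  exists s => //; rewrite inE.
  by move: da; rewrite -sg downs_cycle_of_perm.
rewrite inE => sa; split.
- by rewrite recurrent_cycle_of_perm.
- by apply/forallP => v; apply/implyP => vZ; rewrite cycle_of_perm_notin.
- by rewrite downs_cycle_of_perm.
Qed.

End CycleOfPerm.

Lemma card_pointed_cycles_ex (n m : nat) (Z : {set 'I_n}) :
    #|Z| = m.+1 -> 0 < m ->
  exists2 z0, z0 \in Z & forall a, #|pointed_cycles Z z0 a.+1| = eulerian m a.
Proof.
move=> Zm m0; have [e [e_mono eZ e_onto]] := increasing_enum Zm.
by exists (e ord_max) => // a; apply: card_pointed_cycles.
Qed.

(** * Counting maps with a given cycle length *)

(** Every orbit of [f] enters [Z] and follows [g] from then on. *)
Lemma recurrent_agree (T : finType) (Z : {set T}) (f g : T -> T) :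
    {in Z, f =1 g} -> recurrent g = Z -> absorbing Z f -> recurrent f = Z.
Proof.
move=> fg gZ /forallP aZ.
have gstab z : z \in Z -> g z \in Z by rewrite -gZ; apply: recurrent_stable.
have iterE k z : z \in Z -> iter k f z = iter k g z /\ iter k f z \in Z.
  by move=> zZ; elim: k => //= k [E kZ]; rewrite fg // {1}E; split=> //; apply: gstab.
apply/setP => y; apply/idP/idP => [/recurrentP fy|yZ].
  have /meetsP[k kZ] := aZ y.
  by have [_] := iterE (findex f (iter k f y) y) _ kZ; rewrite iter_findex.
apply/recurrentP => u; have /meetsP[k kZ] := aZ u.
apply: connect_trans (fconnect_iter _ k u) _.
move: yZ; rewrite -gZ => /recurrentP/(_ (iter k f u))/iter_findex <-.
by have [<- _] := iterE (findex g (iter k f u) y) _ kZ; apply: fconnect_iter.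
Qed.

Lemma downs_agree (n : nat) (f g : 'I_n -> 'I_n) :
  recurrent f = recurrent g -> {in recurrent g, f =1 g} -> downs f = downs g.
Proof.
move=> E fg; rewrite /downs E; apply: eq_card => v; rewrite !inE.
by case: (boolP [forall u, _]) => //= gv; rewrite fg // inE.
Qed.

Lemma recurrent_absorbing (T : finType) (f : T -> T) (z : T) :
  z \in recurrent f -> absorbing (recurrent f) f.
Proof.
move=> fz; apply/forallP => u; apply/exists_inP; exists z => //.
exact/recurrentP.
Qed.

(** Redirecting all points outside [Z] to [z0] leaves a pointed cycle. The fiber over each one is
    counted by [card_absorbing], with the same result for all. *)
Lemma card_recurrent_downs (n a m : nat) (Z : {set 'I_n}) :
    #|Z| = m.+1 -> 0 < m ->
  n * #|[set f : {ffun 'I_n -> 'I_n} | (recurrent f == Z) && (downs f == a.+1)]|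
  = eulerian m a * (m.+1 * n ^ (n - m.+1)).
Proof.
move=> Zm m0; have [z0 z0Z gE] := card_pointed_cycles_ex Zm m0.
pose res (f : {ffun 'I_n -> 'I_n}) := [ffun v => if v \in Z then f v else z0].
have fres f : {in Z, res f =1 f} by move=> v vZ; rewrite ffunE vZ.
rewrite -sum1_card (partition_big res (mem (pointed_cycles Z z0 a.+1))) /=.
  rewrite -gE big_distrr -sum_nat_const; apply: eq_bigr => g /=.
  rewrite inE => /and3P[/eqP gZ /forallP g0 /eqP ga].
  rewrite sum1_card -Zm -(card_absorbing Z g); congr (_ * _).
  apply: eq_card => f; rewrite unfold_in !inE.
  apply/andP/andP => [[/andP[/eqP fZ fa] /eqP fg]|[fa /forall_inP fg]].
    split; first by rewrite -fZ (@recurrent_absorbing _ _ z0) // fZ.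
    by apply/forall_inP => z zZ; rewrite -fg fres.
  have {}fg : {in Z, f =1 g} by move=> z /fg/eqP.
  have fZ := recurrent_agree fg gZ fa.
  rewrite fZ eqxx (@downs_agree _ f g) ?gZ // ga eqxx; split=> //.
  apply/eqP/ffunP => v; rewrite ffunE; case: ifPn => [/fg//|vZ].
  by apply/esym/eqP/(implyP (g0 v)).
move=> f; rewrite !inE => /andP[/eqP fZ /eqP fa].
have rZ : recurrent (res f) = Z.
  apply: (recurrent_agree (fres f) fZ); apply/forallP => u; apply/meetsP.
  have [uZ|nuZ] := boolP (u \in Z); first by exists 0.
  by exists 1; rewrite /= ffunE (negPf nuZ).
rewrite rZ eqxx (@downs_agree _ (res f) f) ?fZ // fa eqxx andbT.
by apply/forallP => v; apply/implyP => vZ; rewrite ffunE (negPf vZ).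
Qed.

Lemma card_recurrent (n : nat) (f : 'I_n -> 'I_n) :
  no_2cycle f -> #|recurrent f| = downs f + ups f.
Proof.
move=> f2; rewrite /downs /ups -cardsUI.
rewrite [X in _ + #|pred_of_set X|](_ : _ = set0) ?cards0 ?addn0; last first.
  by apply/setP => v; rewrite !inE; case: ltngtP; rewrite ?andbF.
apply: eq_card => v; rewrite !inE -andb_orr.
have := no_2cycle_neq v f2; rewrite -val_eqE neq_ltn => ->.
by rewrite andbT.
Qed.

(** If [f (f v) = v], then [v] reaches only [v] and [f v], so no other point is recurrent. *)
Lemma recurrent_no_2cycle (T : finType) (f : T -> T) :
  2 < #|recurrent f| -> no_2cycle f.
Proof.
move=> f2; apply/forallP => v; apply: contraL f2 => /eqP ffv; rewrite -leqNgt.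
apply: leq_trans (_ : #|[set v; f v]| <= 2); last by rewrite cards2; case: eqP.
apply/subset_leq_card/subsetP => z /recurrentP/(_ v)/iter_findex <-.
elim: (findex _ _ _) => [|k] /=; first by rewrite set21.
by case/set2P=> ->; rewrite ?ffv ?set21 ?set22.
Qed.

Lemma no_2cycle_recurrent (T : finType) (f : T -> T) (z : T) :
  no_2cycle f -> z \in recurrent f -> 2 < #|recurrent f|.
Proof.
move=> f2 fz; have fz1 := recurrent_stable fz; have fz2 := recurrent_stable fz1.
rewrite (cardsD1 z) fz (cardsD1 (f z)) (cardsD1 (f (f z))) !in_setD1 fz1 fz2.
by rewrite !(no_2cycle_neq _ f2) (forallP f2).
Qed.

Lemma card_sign_funs (n a b : nat) :
    0 < a -> 2 < a + b -> #|sign_funs n a b| = u_num n a b.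
Proof.
move=> a0 ab.
have [m cE] : exists m, a + b = m.+1 by exists (a + b).-1; rewrite prednK // ltnW // ltnW.
have m0 : 0 < m by rewrite -ltnS -cE ltnW.
(* The factor [n.+1] matches [card_recurrent_downs]; in the end [mul_bin_diag] absorbs it, turning
   [m.+1 * 'C(n.+1, m.+1)] into [n.+1 * 'C(n, m)]. *)
apply/eqP; rewrite -(@eqn_pmul2l n.+1) //; apply/eqP.
pose rec (f : {ffun 'I_n.+1 -> 'I_n.+1}) := recurrent f.
rewrite -sum1_card (partition_big rec (fun Z => #|Z| == m.+1)) /=; last first.
  move=> f; rewrite inE => /and3P[f2 /eqP fa /eqP fb].
  by rewrite /rec card_recurrent // fa fb cE.
rewrite big_distrr /=.
rewrite (eq_bigr (fun=> eulerian m a.-1 * (m.+1 * n.+1 ^ (n.+1 - m.+1)))); last first.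
  move=> Z /eqP Zm; rewrite -(card_recurrent_downs a.-1 Zm m0) sum1_card.
  congr (_ * _); apply: eq_card => f; rewrite unfold_in !inE prednK // andbC.
  rewrite /rec; have [fZ|] //= := eqVneq (recurrent f) Z.
  have f2 : no_2cycle f by apply: recurrent_no_2cycle; rewrite fZ Zm -cE.
  (* The size of [Z] is [a + b], so [downs f = a] already forces [ups f = b]. *)
  rewrite f2 /=; have := card_recurrent f2; rewrite fZ Zm -cE.
  have [->|] //= := eqVneq (downs f) a.
  by move/eqP; rewrite eqn_add2l eq_sym.
rewrite sum_nat_const -(cardsE (fun Z : {set 'I_n.+1} => #|Z| == m.+1)).
rewrite (card_draws 'I_n.+1 m.+1) card_ord /u_num -subnDA cE subn1 /=.
rewrite subn1 mulnCA (mulnA 'C(_, _)) (mulnC 'C(_, _)) -(mul_bin_diag n.+1).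
by rewrite [LHS]mulnC /= -!mulnA (mulnCA 'C(_, _)).
Qed.

Theorem theorem1p7 (n a b : nat) (hn : 1 <= n) (ha : 1 <= a) (hab : a <= b)
    (hb : b <= n.+1) (habn : a + b <= n.+1) :
  [/\ a < b -> s_num n a b = u_num n a b,
      a = b -> a <> 1 ->
        ((s_num n a b)%:R = 2^-1 * (u_num n a b)%:R :> rat)%R
    & a = 1 -> b = 1 -> s_num n a b = 0].
Proof.
split=> [ltab|eab a1|-> ->].
- rewrite s_num_lt // card_sign_funs //.
  by apply: leq_ltn_trans (leq_add ha ha) _; rewrite ltn_add2l.
- subst b; rewrite -card_sign_funs //; last first.
    case: a ha a1 {hab hb habn} => [|[|a]] // _ _; by rewrite addSn addnS.
  by rewrite s_num_eq // natrM mulKf.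
(* One descent and one ascent would make a cycle of two vertices, while [no_2cycle] forces at least
   three. *)
- apply/eqP; rewrite -(@eqn_pmul2l 2) // muln0 -s_num_eq // cards_eq0.
  apply/eqP/setP => f; rewrite !inE; apply/and3P => -[f2 /eqP d1 /eqP u1].
  have [z fz] : exists z, z \in recurrent f by apply: recurrent_ex; rewrite d1.
  by have := no_2cycle_recurrent f2 fz; rewrite card_recurrent // d1 u1.
Qed.
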